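(* Let $f:X\to Y$ be an affine map of compact convex sets and let $\pi:Y\to\mathrm{coker}(f)$ be the canonical map. The functor $\mathrm{coker}^*(f):\mathbf{Conv}^{\mathrm{op}}\to\mathbf{Conv}$ is representable if and only if $\pi$ has an affine section, in which case $\mathrm{coker}^*(f)=\mathrm{Hom}(-,\mathrm{coker}(f))$.
   Context: All vector spaces are finite-dimensional and real. $\mathbf{Conv}$ is the category of compact convex subsets of vector spaces and affine maps (maps respecting barycentric coordinates). $\mathrm{Hom}(A,B)$ is the set of affine maps $A\to B$, viewed as a compact convex subset of the affine space of affine maps $\mathrm{Aff}(A)\to\mathrm{Aff}(B)$ ($\mathrm{Aff}$ = affine hull); $\mathrm{Hom}(-,A)$ acts on morphisms by precomposition. A contravariant functor $\mathbf{Conv}\to\mathbf{Conv}$ is representable if it is isomorphic to $\mathrm{Hom}(-,A)$ for some $A\in\mathbf{Conv}$. For $f:X\to Y$ in $\mathbf{Conv}$, the object $\mathrm{coker}(f)\in\mathbf{Conv}$ is the colimit (coequalizer) of the two parallel maps $f$ and $c$ from $X$ to $Y$, where $c$ is a constant map with value a point of $f(X)$. It does not depend on the choice of the point and is identified with $\pi(Y)$, where $\pi:\mathrm{Aff}(Y)\to\mathrm{Aff}(Y)$ is an affine map with $\pi^{-1}(\pi(f(x)))=\mathrm{Aff}(f(X))$ for any $x\in X$ (a linear projection along $\mathrm{Aff}(f(X))$); the canonical map $Y\to\mathrm{coker}(f)$ is the restriction of $\pi$. The functor $\mathrm{coker}^*(f)$ assigns to $Z\in\mathbf{Conv}$ the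 quotient $\mathrm{Hom}(Z,Y)/\sim$, where $g_1\sim g_2$ iff $\rho g_1=\rho g_2$ for every affine map $\rho:Y\to Y'$ in $\mathbf{Conv}$ with $(\rho f)(X)$ a singleton; on a morphism $h:Z'\to Z$ it is $[g]\mapsto[gh]$. Since $g_1\sim g_2$ iff $\pi g_1=\pi g_2$, $\mathrm{coker}^*(f)(Z)$ is identified with the compact convex set $\mathrm{Im}\big(\mathrm{Hom}(Z,\pi):\mathrm{Hom}(Z,Y)\to\mathrm{Hom}(Z,\pi(Y)),\ g\mapsto\pi g\big)$, which makes $\mathrm{coker}^*(f)$ a contravariant functor $\mathbf{Conv}\to\mathbf{Conv}$. *)

(* Defs.v *)
From HB Require Import structures.
From mathcomp Require Import all_boot all_order all_algebra.
From mathcomp Require Import interval_inference all_classical all_reals.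
From mathcomp Require Import topology normedtype convex.

Set Implicit Arguments.
Unset Strict Implicit.
Unset Printing Implicit Defensive.

Import Order.TTheory GRing.Theory Num.Theory Num.Def.
Import numFieldNormedType.Exports.

Local Open Scope classical_set_scope.
Local Open Scope ring_scope.
Local Open Scope convex_scope.

Section LinearAlgebra.
Variable (K : fieldType).

Lemma submod_vspace (V : vectType K) (S : set V) :
  S 0 -> (forall a u v, S u -> S v -> S (a *: u + v)) ->
  exists U : {vspace V}, forall v, v \in U <-> S v.
Proof.
move=> S0 Slin.
pose P n := `[< exists U : {vspace V}, \dim U = n /\ forall v, v \in U -> S v >].
have exP : exists n, P n.
  exists 0%N; apply/asboolP; exists 0%VS; split; first exact: dimv0.
  by move=> v; rewrite memv0 => /eqP->.
have ubP n : P n -> (n <= \dim {: V})%N.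
  by move=> /asboolP[U [<- _]]; exact/dimvS/subvf.
case: (ex_maxnP exP ubP) => n /asboolP[U [dU US]] nmax.
exists U => v; split; first exact: US.
move=> Sv; apply: contrapT => /negP vU.
have : P (\dim (U + <[v]>)%VS).
  apply/asboolP; exists (U + <[v]>)%VS; split => // w /memv_addP[u uU].
  case=> _ /vlineP[k ->] ->; rewrite addrC; apply: Slin => //; exact: US.
move=> /nmax; rewrite leqNgt -dU => /negP; apply.
rewrite ltn_neqAle dimvS ?addvSl// andbT; apply: contra vU => /eqP dE.
have /eqP -> : U == (U + <[v]>)%VS by rewrite eqEdim addvSl -dE /=.
by rewrite memvE addvSr.
Qed.

Lemma vspan_subproof (V : vectType K) (S : set V) :
  exists U : {vspace V}, forall v, v \in U <->
    forall U' : {vspace V}, (forall s, S s -> s \in U') -> v \in U'.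
Proof.
apply: (@submod_vspace V (fun v => forall U' : {vspace V}, (forall s, S s -> s \in U') -> v \in U')).
  by move=> U _; exact: mem0v.
by move=> a u v Su Sv U SU; rewrite rpredD ?rpredZ ?Su ?Sv.
Qed.

(* The smallest linear subspace containing S. *)
Definition vspan (V : vectType K) (S : set V) : {vspace V} :=
  sval (cid (vspan_subproof S)).

Lemma mem_vspan (V : vectType K) (S : set V) v : S v -> v \in vspan S.
Proof. by move=> Sv; apply/(svalP (cid (vspan_subproof S))) => U; exact. Qed.

Lemma vspan_min (V : vectType K) (S : set V) (U : {vspace V}) :
  (forall s, S s -> s \in U) -> (vspan S <= U)%VS.
Proof.
move=> SU; apply/subvP => v /(svalP (cid (vspan_subproof S))); exact.
Qed.

Definition coords (V : vectType K) : V -> 'rV[K]_(\dim {: V}) :=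
  passmx.rVof (vbasis {: V}).

HB.instance Definition _ (V : vectType K) :=
  GRing.isLinear.Build K V _ *:%R (coords (V := V)) (@passmx.rVof_linear K V (vbasis {: V})).

Definition vec (V : vectType K) : 'rV[K]_(\dim {: V}) -> V :=
  passmx.vecof (vbasis {: V}).

HB.instance Definition _ (V : vectType K) :=
  GRing.isLinear.Build K _ V *:%R (vec (V := V)) (@passmx.vecof_linear K V (vbasis {: V})).

Lemma coordsK (V : vectType K) : cancel (coords (V := V)) (vec (V := V)).
Proof. by apply: passmx.rVofK; exact: vbasisP. Qed.

Lemma vecK (V : vectType K) : cancel (vec (V := V)) (coords (V := V)).
Proof. by apply: passmx.vecofK; exact: vbasisP. Qed.

Lemma surj_findim (E : vectType K) (M : lmodType K) (phi : {linear E -> M}) :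
  (forall m, exists e, phi e = m) -> {n & Vector.axiom n M}.
Proof.
move=> phis.
have [U kerU] : {U : {vspace E} | forall v, v \in U <-> phi v = 0}.
  apply/cid; apply: (@submod_vspace E (fun v => phi v = 0)); first by rewrite linear0.
  by move=> a u v u0 v0; rewrite linearP u0 v0 scaler0 addr0.
have inj (u v : subvs_of U^C) : phi (vsval u) = phi (vsval v) -> u = v.
  move=> uv; apply/subvs_inj/eqP; rewrite -subr_eq0 -memv0 -(capv_compl U).
  rewrite memv_cap; apply/andP; split; last by rewrite rpredB ?subvsP.
  apply/kerU.
  by rewrite linearB /= uv subrr.
have surj m : {u : subvs_of U^C | phi (vsval u) = m}.
  apply: cid; have [e <-] := phis m.
  exists (vsproj U^C (e - projv U e)).
  rewrite vsprojK ?memv_projC// linearB /=.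
  by rewrite (_ : phi (projv U e) = 0) ?subr0//; apply/kerU/memv_proj.
pose g m := sval (surj m).
have gK m : phi (vsval (g m)) = m by exact: (svalP (surj m)).
pose S := subvs_of U^C.
exists (\dim {: S}), (coords (V := S) \o g).
  move=> a u v /=; rewrite -[RHS](linearP (coords (V := S))); congr coords.
  apply: inj; have -> : vsval (a *: g u + g v) = a *: vsval (g u) + vsval (g v) by [].
  by rewrite linearP !gK.
exists (fun r => phi (vsval (vec r : S))) => [m|r] /=; first by rewrite coordsK gK.
have -> : g (phi (vsval (vec r : S))) = vec r by apply: inj; rewrite gK.
exact: vecK.
Qed.

End LinearAlgebra.

Section FiniteDimensionalTopology.
Variable (R : realType).

(* A finite-dimensional real vector space carries a unique Hausdorff vector
   topology; it is the one read off in the coordinates of any basis. *)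
Definition compactv (V : vectType R) (A : set V) :=
  compact (coords (V := V) @` A).

Lemma linear_rV_continuous n m (L : {linear 'rV[R]_n -> 'rV[R]_m}) : continuous L.
Proof.
apply: bounded_linear_continuous; apply/linear_boundedP.
near=> r => x; rewrite {1}[x]row_sum_delta linear_sum /=.
apply: (@le_trans _ _ (\sum_j `|x| * `|L (delta_mx 0 j)|)).
  apply: le_trans (ler_norm_sum _ _ _) _; apply: ler_sum => j _.
  rewrite linearZ /= normrZ ler_wpM2r//.
  rewrite [leRHS]/normr /= mx_normrE; apply/bigmax_geP; right => /=.
  by exists (ord0, j).
rewrite -mulr_sumr mulrC ler_wpM2r//; near: r; exact/nbhs_pinfty_ge/num_real.
Unshelve. all: by end_near. Qed.


Lemma compactv_linear (V W : vectType R) (L : {linear V -> W}) (A : set V) :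
  compactv A -> compactv (L @` A).
Proof.
rewrite /compactv => cA.
pose M : {linear 'rV[R]_(\dim {: V}) -> 'rV[R]_(\dim {: W})} :=
  (coords (V := W)) \o (L \o (vec (V := V))).
have -> : (coords (V := W)) @` (L @` A) = M @` (coords (V := V) @` A).
  rewrite !image_comp; congr (_ @` _).
  by apply/funext => v /=; rewrite coordsK.
apply: continuous_compact => //.
by apply: continuous_subspaceT; exact: linear_rV_continuous.
Qed.

Lemma separating_bounded (E : vectType R) (B : set E) (T : Type) (W : vectType R)
    (ev : T -> {linear E -> W}) :
  (forall e, (forall a, ev a e = 0) -> e = 0) ->
  (forall a, exists C : R, forall e, B e -> `|coords (ev a e)| <= C) ->
  exists C : R, forall e, B e -> `|coords e| <= C.
Proof.
move=> sep bnd.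
pose n := \dim {: E}.
pose S (c : 'rV[R]_n) := exists C : R, forall e, B e ->
  `|\sum_j coords e 0 j * c 0 j| <= C.
have coordle m (r : 'rV[R]_m) i : `|r 0 i| <= `|r|.
  rewrite [leRHS]/normr /= mx_normrE; apply/bigmax_geP; right => /=.
  by exists (ord0, i).
have [U US] : exists U : {vspace 'rV[R]_n}, forall v, v \in U <-> S v.
  apply: (@submod_vspace _ _ S).
    by exists 0 => e _; rewrite big1 ?normr0// => j _; rewrite [X in _ * X]mxE mulr0.
  move=> a u v [C uC] [D vD]; exists (`|a| * C + D) => e Be.
  rewrite (_ : \sum_j _ = a * (\sum_j coords e 0 j * u 0 j) + \sum_j coords e 0 j * v 0 j).
    by rewrite (le_trans (ler_normD _ _))// normrM lerD ?vD// ler_wpM2l ?uC.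
  rewrite mulr_sumr -big_split; apply: eq_bigr => j _ /=.
  by rewrite [X in _ * X]mxE [X in _ * (X + _)]mxE mulrDr mulrCA.
have Ufull : U = fullv.
  apply: contrapT => Un.
  have dU : (\dim U < n)%N.
    have nE : n = \dim {: 'rV[R]_n} by rewrite dimvf /dim /= mul1n.
    apply: (@leq_trans (\dim {: 'rV[R]_n})); last by rewrite -nE.
    rewrite ltn_neqAle dimvS ?subvf// andbT; apply/eqP => dE; apply: Un.
    by apply/eqP; rewrite eqEdim subvf dE /=.
  pose X := \matrix_(j < n, k < \dim U) (vbasis U)`_k 0 j.
  have : kermx X != 0.
    by rewrite kermx_eq0 /row_free neq_ltn (leq_ltn_trans (rank_leq_col _) dU).
  move=> /rowV0Pn[r /sub_kermxP rX r0].
  have rU c : c \in U -> \sum_j r 0 j * c 0 j = 0.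
    move=> cU; rewrite (coord_vbasis cU).
    under eq_bigr do rewrite summxE mulr_sumr.
    rewrite exchange_big big1//= => k _.
    have rk : \sum_j r 0 j * (vbasis U)`_k 0 j = 0.
      have := congr1 (fun M : 'rV_ _ => M 0 k) rX; rewrite !mxE => rX0; rewrite -[RHS]rX0.
      by apply: eq_bigr => j _; rewrite mxE.
    under eq_bigr do rewrite mxE mulrCA.
    by rewrite -mulr_sumr rk mulr0.
  move/eqP: r0; apply; rewrite -[r]vecK [vec r]sep ?linear0// => a.
  rewrite -[LHS]coordsK (_ : coords _ = 0) ?linear0//.
  apply/rowP => i; rewrite [RHS]mxE.
  pose c := \row_j coords (ev a (vec (delta_mx 0 j))) 0 i : 'rV[R]_n.
  have cE e : coords (ev a e) 0 i = \sum_j coords e 0 j * c 0 j.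
    have -> : coords (ev a e) = \sum_j coords e 0 j *: coords (ev a (vec (delta_mx 0 j))).
      pose M : {linear 'rV[R]_n -> 'rV[R]_(\dim {: W})} :=
        coords (V := W) \o (ev a \o vec (V := E)).
      rewrite -[LHS]/(coords (ev a e)) -{1}[e]coordsK -[LHS]/(M (coords e)).
      rewrite {1}[coords e]row_sum_delta (linear_sum M).
      by apply: eq_bigr => j _; rewrite (linearZ_LR M).
    by rewrite summxE; apply: eq_bigr => j _; rewrite [LHS]mxE [c 0 j]mxE.
  rewrite cE vecK; apply: rU; apply/US.
  have [C aC] := bnd a; exists C => e Be.
  by rewrite -cE (le_trans (coordle _ _ _)) ?aC.
have Cj j : exists C : R, forall e, B e -> `|coords e 0 j| <= C.
  have [|C jC] := (US (delta_mx 0 j)).1; first by rewrite Ufull memvf.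
  exists C => e /jC; rewrite (bigD1 j)//= [X in _ * X]mxE !eqxx mulr1 big1 ?addr0// => k kj.
  by rewrite [X in _ * X]mxE eqxx (negbTE kj) mulr0.
pose C j := sval (cid (Cj j)).
exists (\sum_j `|C j|) => e Be.
rewrite [leLHS]/normr /= mx_normrE; apply/bigmax_leP; split=> [|[i j] _] /=.
  by apply: sumr_ge0.
rewrite ord1 (le_trans (svalP (cid (Cj j)) e Be))// (le_trans (ler_norm _))//.
by rewrite (bigD1 j)//= lerDl sumr_ge0.
Qed.

Lemma compactv_eval (E : vectType R) (T : Type) (W : vectType R)
    (ev : T -> {linear E -> W}) (B : set W) :
  (forall e, (forall a, ev a e = 0) -> e = 0) ->
  compactv B -> compactv [set e | forall a, B (ev a e)].
Proof.
move=> sep cB.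
apply: bounded_closed_compact.
  have [|C Cb] := separating_bounded (B := [set e | forall a, B (ev a e)]) sep.
    move=> a; have [M [_ MB]] := compact_bounded cB.
    exists (M + 1) => e Be; apply: MB; first by rewrite ltrDl.
    by exists (ev a e) => //; exact: Be.
  exists C; split; first exact: num_real.
  by move=> x Cx _ [e Be <-]; exact: le_trans (Cb _ Be) (ltW Cx).
have -> : (coords (V := E)) @` [set e | forall a, B (ev a e)] =
    \bigcap_a ((coords (V := W) \o (ev a \o (vec (V := E)))) @^-1` (coords (V := W) @` B)).
  apply/seteqP; split => [_ [e Be <-] a _ /=|r Br].
    by rewrite coordsK; exists (ev a e) => //; exact: Be.
  exists (vec r); last exact: vecK.
  by move=> a; have [w Bw /(can_inj (coordsK (V := W))) wE] := Br a I; rewrite wE in Bw.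
apply: closed_bigI => a _; apply: closed_comp.
  by move=> x _; exact: (@linear_rV_continuous _ _ (coords (V := W) \o (ev a \o (vec (V := E))))).
by apply: compact_closed => //; exact: norm_hausdorff.
Qed.

End FiniteDimensionalTopology.

Lemma conv_lmodE (R : realType) (V : lmodType R) (t : {i01 R}) (x y : V) :
  (x : convex_lmodType V) <| t |> y = t%:num *: x + (1 - t%:num) *: y.
Proof. by []. Qed.

Lemma conv_difference (R : realType) (s t : R) : 0 < s -> 0 <= t ->
  exists p : {i01 R}, forall (V : lmodType R) (x y x' y' : V),
    s *: (x - y) + t *: (x' - y') = (s + t) *:
      ((x : convex_lmodType V) <| p |> x' - (y : convex_lmodType V) <| p |> y').
Proof.
move=> s0 t0; have st0 : s + t != 0 by rewrite gt_eqF// ltr_wpDr.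
have p0 : 0 <= s / (s + t) by rewrite divr_ge0 ?addr_ge0 ?(ltW s0).
have p1 : s / (s + t) <= 1 by rewrite ler_pdivrMr ?mul1r ?lerDl// ltr_wpDr.
exists (Itv01 p0 p1) => V x y x' y'; apply/esym.
rewrite !conv_lmodE /= scalerBr !scalerDr !scalerA.
rewrite [(s + t) * (s / _)]mulrC divfK// mulrBr mulr1 [(s + t) * (s / _)]mulrC divfK//.
have -> : s + t - s = t by rewrite addrAC subrr add0r.
by rewrite opprD addrACA -!scalerBr !scalerDr.
Qed.

Section CompactConvexSets.
Variable (R : realType).

Record Conv := MkConv {
  amb : vectType R;
  body : set amb;
  body_convex : convex_set (body : set (convex_lmodType amb));
  body_compact : compactv body }.

Definition pt (A : Conv) : Type := set_type (@body A).

End CompactConvexSets.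

Coercion pt : Conv >-> Sortclass.

Section ConvexStructure.
Variables (R : realType) (A : Conv R).

HB.instance Definition _ := Choice.copy A (set_type (@body R A)).
HB.instance Definition _ := SubChoice.copy A (set_type (@body R A)).

Let pt_conv (t : {i01 R}) (x y : A) : A :=
  Sub ((\val x : convex_lmodType (amb A)) <| t |> \val y)
    (body_convex t (valP x) (valP y)).

Let pt_conv1 x y : pt_conv 1%:i01 x y = x.
Proof. by apply/val_inj; rewrite SubK conv1. Qed.

Let pt_convmm t x : pt_conv t x x = x.
Proof. by apply/val_inj; rewrite SubK convmm. Qed.

Let pt_convC (t : {i01 R}) x y : pt_conv t x y = pt_conv (1 - t%:inum)%:i01 y x.
Proof. by apply/val_inj; rewrite !SubK convC. Qed.

Let pt_convA : convex_quasi_associative pt_conv.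
Proof.
move=> p q r s a b c prs spq; apply/val_inj; rewrite !SubK.
exact: (@convA R (convex_lmodType (amb A)) p q r s _ _ _ prs spq).
Qed.

HB.instance Definition _ :=
  isConvexSpace.Build R A pt_conv1 pt_convmm pt_convC pt_convA.

Lemma val_conv (t : {i01 R}) (x y : A) :
  \val (x <| t |> y) = (\val x : convex_lmodType (amb A)) <| t |> \val y.
Proof. by []. Qed.

Lemma pt_body (x : A) : body (\val x).
Proof. exact: set_mem (valP x). Qed.

End ConvexStructure.

Definition mkpt (R : realType) (A : Conv R) (v : amb A) (vA : body v) : A :=
  Sub v (mem_set vA).

Definition affine (R : realType) (T U : convType R) (f : T -> U) :=
  forall t x y, f (x <| t |> y) = f x <| t |> f y.

Section AffineMaps.
Variables (R : realType) (A : Conv R) (W : vectType R).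

Definition affmap_pred : {pred A -> W} :=
  [pred f : A -> W | `[< affine (f : A -> convex_lmodType W) >] ].

Fact affmap_submod_closed : submod_closed affmap_pred.
Proof.
split=> [|a f g].
  by rewrite inE => t x y; apply/esym; exact: convmm.
rewrite !inE => fA gA t x y.
rewrite -[LHS]/(a *: f _ + g _) fA gA !conv_lmodE.
rewrite -[(a *: f + g) x]/(a *: f x + g x) -[(a *: f + g) y]/(a *: f y + g y).
by rewrite !scalerDr !scalerA ![a * _]mulrC addrACA.
Qed.

HB.instance Definition _ :=
  GRing.isSubmodClosed.Build R (A -> W) affmap_pred affmap_submod_closed.

(* The vector space of affine maps A -> W. Restriction identifies it with the
   affine maps Aff(A) -> W, see affmap_extends. *)
Record affmap := AffMap {
  affmap_fun :> A -> W;
  _ : affmap_fun \in affmap_pred }.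

HB.instance Definition _ := [isSub for affmap_fun].
HB.instance Definition _ := [Choice of affmap by <:].
HB.instance Definition _ := [SubChoice_isSubLmodule of affmap by <:].

Definition mkaffmap (f : A -> W)
    (fA : affine (f : A -> convex_lmodType W)) : affmap :=
  AffMap (introT (asboolP _) fA).

Lemma affmapP (f : affmap) : affine (f : A -> convex_lmodType W).
Proof. by case: f => f /= /asboolP. Qed.

Lemma affmap_ext (f g : affmap) : (forall a, f a = g a) -> f = g.
Proof. by move=> fg; apply/val_inj/funext. Qed.

Let difference (t : R) (a b : A) (f : affmap) : amb A * W :=
  (t *: (\val a - \val b), t *: (f a - f b)).

Let differenceD (f : affmap) (s t : R) (a b a' b' : A) : 0 < s -> 0 <= t ->
  exists r c d, 0 <= r /\ difference s a b f + difference t a' b' f = difference r c d f.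
Proof.
move=> s0 t0; have [p pE] := conv_difference s0 t0.
exists (s + t), (a <| p |> a'), (b <| p |> b'); split; first by rewrite addr_ge0// ltW.
by rewrite /difference !(affmapP f) !val_conv; congr pair; exact: pE.
Qed.

Lemma affmap_extends (f : affmap) :
  exists (L : 'Hom(amb A, W)) (w : W), forall a, f a = L (\val a) + w.
Proof.
pose G (z : amb A * W) := z = 0 \/ exists t a b, 0 <= t /\ z = difference t a b f.
have diffZ k t a b : k *: difference t a b f = difference (k * t) a b f.
  by apply: injective_projections; rewrite /= scalerA.
have diffN t a b : difference (- t) a b f = difference t b a f.
  by apply: injective_projections; rewrite /= scaleNr -scalerN opprB.
have [U UG] : exists U : {vspace amb A * W}, forall z, z \in U <-> G z.
  apply: submod_vspace; first by left.
  have GZ k z : G z -> G (k *: z).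
    move=> [->|[t [a [b [t0 ->]]]]]; first by left; rewrite scaler0.
    right; rewrite diffZ; have [k0|/ltW k0] := leP 0 k.
      by exists (k * t), a, b; rewrite mulr_ge0.
    by exists (- (k * t)), b, a; rewrite diffN oppr_ge0 mulr_le0_ge0.
  move=> k u v /(GZ k); set ku := k *: u => Gu Gv.
  case: Gu => [->|[s [a [b [s0 sE]]]]]; first by rewrite add0r.
  case: Gv => [->|[t [a' [b' [t0 tE]]]]].
    by rewrite addr0; right; exists s, a, b.
  right; move: s0; rewrite le_eqVlt => /orP[/eqP s0|s0].
    exists t, a', b'; split=> //; rewrite sE tE -s0.
    by apply: injective_projections; rewrite /= scale0r add0r.
  have [r [c [d [r0 E]]]] := differenceD f a b a' b' s0 t0.
  by exists r, c, d; rewrite sE tE.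
pose p : 'Hom(subvs_of U, amb A) := linfun (fst \o vsval).
have pE u : p u = (vsval u).1 by rewrite lfunE.
have kp : lker p == 0%VS.
  apply/lker0P => u v; rewrite !pE => uv; apply: subvs_inj; apply/eqP.
  rewrite -subr_eq0; apply/eqP.
  have /UG : vsval u - vsval v \in U by rewrite rpredB ?subvsP.
  case=> // -[t [a [b [_ E]]]].
  have : (vsval u - vsval v).1 = 0 by rewrite /= uv subrr.
  rewrite E /= => /eqP; rewrite scaler_eq0 subr_eq0 => /orP[/eqP->|/eqP/val_inj->].
    by apply: injective_projections; rewrite /= scale0r.
  by apply: injective_projections; rewrite /= subrr scaler0.
pose q : 'Hom(subvs_of U, W) := linfun (snd \o vsval).
pose L := (q \o p^-1)%VF.
have LE a b : L (\val a - \val b) = f a - f b.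
  have dU : difference 1 a b f \in U by apply/UG; right; exists 1, a, b.
  have -> : \val a - \val b = p (Subvs dU) by rewrite pE /= scale1r.
  by rewrite comp_lfunE lker0_lfunK// lfunE /= scale1r.
have [a0|A0] := pselect (exists a : A, True).
  have [a _] := a0; exists L, (f a - L (\val a)) => b.
  by have := LE b a; rewrite linearB => /(canRL (subrK _)) ->; rewrite addrACA subrK subrr addr0.
exists 0, 0 => a; case: A0; by exists a.
Qed.

Fact affmap_of_subproof (L : 'Hom(amb A, W) * W) :
  affine ((fun a : A => L.1 (\val a) + L.2) : A -> convex_lmodType W).
Proof.
move=> t x y; rewrite val_conv !conv_lmodE linearD !linearZ /= !scalerDr addrACA.
by congr (_ + _); rewrite -scalerDl addrC subrK scale1r.
Qed.

Definition affmap_of (L : 'Hom(amb A, W) * W) : affmap :=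
  mkaffmap (affmap_of_subproof L).

Fact affmap_of_linear : linear affmap_of.
Proof.
move=> k u v; apply: affmap_ext => a.
rewrite -[RHS]/(k *: (u.1 (\val a) + u.2) + (v.1 (\val a) + v.2)).
by rewrite /= !lfunE /= lfunE /= scalerDr addrACA.
Qed.

HB.instance Definition _ :=
  GRing.isLinear.Build R _ affmap *:%R affmap_of affmap_of_linear.

Let affmap_findim : {n & Vector.axiom n affmap}.
Proof.
apply: (@surj_findim R ('Hom(amb A, W) * W)%type affmap affmap_of) => f.
have [L [w fE]] := affmap_extends f.
by exists (L, w); apply: affmap_ext => a; rewrite fE.
Qed.

HB.instance Definition _ := Lmodule_hasFinDim.Build R affmap (projT2 affmap_findim).

End AffineMaps.

Lemma linear_conv (R : realType) (V W : lmodType R) (L : {linear V -> W})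
    (t : {i01 R}) (x y : V) :
  L ((x : convex_lmodType V) <| t |> y) = (L x : convex_lmodType W) <| t |> L y.
Proof. by rewrite !conv_lmodE linearD !linearZ. Qed.

Lemma convex_linear (R : realType) (V W : lmodType R) (L : {linear V -> W})
    (A : set V) :
  convex_set (A : set (convex_lmodType V)) ->
  convex_set (L @` A : set (convex_lmodType W)).
Proof.
move=> cA _ _ t /set_mem[x Ax <-] /set_mem[y Ay <-]; apply/mem_set.
rewrite -linear_conv; eexists; last reflexivity.
by apply/set_mem/cA; exact: mem_set.
Qed.

Section HomObject.
Variables (R : realType) (A B : Conv R).

Definition hom_body : set (affmap A (amb B)) := [set f | forall a, body (f a)].

Definition hom_eval (a : A) (f : affmap A (amb B)) : amb B := f a.

Fact hom_eval_linear a : linear (hom_eval a). Proof. by []. Qed.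

HB.instance Definition _ a :=
  GRing.isLinear.Build R _ (amb B) *:%R (hom_eval a) (hom_eval_linear a).

Fact hom_convex : convex_set (hom_body : set (convex_lmodType _)).
Proof.
move=> f g t /set_mem fB /set_mem gB; apply/mem_set => a.
rewrite -[_ a]/(hom_eval a _) (linear_conv (hom_eval a)).
by apply/set_mem/body_convex; apply/mem_set; [exact: fB | exact: gB].
Qed.

Fact hom_compact : compactv hom_body.
Proof.
apply: (@compactv_eval _ _ A (amb B) hom_eval (@body _ B)); last exact: body_compact.
by move=> f f0; apply: affmap_ext => a; exact: f0.
Qed.

(* Hom(A, B) as a compact convex subset of the space of affine maps; its points
   are the morphisms from A to B. *)
Definition homC : Conv R := MkConv hom_convex hom_compact.

Definition app (f : homC) (a : A) : B := mkpt (pt_body f a).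

Lemma val_app f a : \val (app f a) = \val f a.
Proof. by []. Qed.

Lemma app_affine f : affine (app f).
Proof. by move=> t x y; apply/val_inj; rewrite val_app affmapP. Qed.

Lemma hom_ext (f g : homC) : (forall a, app f a = app g a) -> f = g.
Proof.
move=> fg; apply/val_inj/affmap_ext => a.
by have := congr1 val (fg a); rewrite !val_app.
Qed.

Fact mkhom_subproof (phi : A -> B) (phiA : affine phi) :
  affine ((fun a => \val (phi a)) : A -> convex_lmodType (amb B)).
Proof. by move=> t x y; rewrite phiA val_conv. Qed.

Definition mkhom (phi : A -> B) (phiA : affine phi) : homC :=
  @mkpt R homC (mkaffmap (mkhom_subproof phiA)) (fun a => pt_body (phi a)).

Lemma app_mkhom (phi : A -> B) (phiA : affine phi) a : app (mkhom phiA) a = phi a.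
Proof. exact/val_inj. Qed.

End HomObject.

Section Category.
Variable R : realType.
Implicit Types A B C : Conv R.

Fact id_affine A : affine (@id A). Proof. by []. Qed.

Definition idC A : homC A A := mkhom (@id_affine A).

Fact comp_affine A B C (g : homC B C) (f : homC A B) : affine (app g \o app f).
Proof. by move=> t x y /=; rewrite !app_affine. Qed.

Definition compC A B C (g : homC B C) (f : homC A B) : homC A C :=
  mkhom (comp_affine g f).

Lemma app_comp A B C (g : homC B C) (f : homC A B) a :
  app (compC g f) a = app g (app f a).
Proof. exact: app_mkhom. Qed.

Lemma app_id A (a : A) : app (idC A) a = a.
Proof. exact: app_mkhom. Qed.

Fact const_affine A B (b : B) : affine (fun _ : A => b).
Proof. by move=> t x y; rewrite convmm. Qed.

Definition constC A B (b : B) : homC A B := mkhom (@const_affine A B b).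

Lemma app_const A B (b : B) (a : A) : app (constC A b) a = b.
Proof. exact: app_mkhom. Qed.

(* Contravariant functors from Conv to Conv. *)
Record cofunctor := MkCofunctor {
  fobj :> Conv R -> Conv R;
  fhom : forall Z Z' : Conv R, homC Z' Z -> homC (fobj Z) (fobj Z');
  fhom_id : forall Z, fhom (idC Z) = idC (fobj Z);
  fhom_comp : forall Z Z' Z'' (h : homC Z' Z) (k : homC Z'' Z'),
    fhom (compC h k) = compC (fhom k) (fhom h) }.

Definition nat_iso (F G : cofunctor) :=
  exists (phi : forall Z, homC (F Z) (G Z)) (psi : forall Z, homC (G Z) (F Z)),
    [/\ forall Z, compC (psi Z) (phi Z) = idC (F Z),
        forall Z, compC (phi Z) (psi Z) = idC (G Z) &
        forall (Z Z' : Conv R) (h : homC Z' Z),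
          compC (phi Z') (fhom F h) = compC (fhom G h) (phi Z)].

Fact precomp_affine Z Z' (W : vectType R) (u : affmap Z W) (h : homC Z' Z) :
  affine ((u \o app h) : Z' -> convex_lmodType W).
Proof. by move=> t x y /=; rewrite app_affine affmapP. Qed.

Definition precomp Z Z' (W : vectType R) (u : affmap Z W) (h : homC Z' Z) :
  affmap Z' W := mkaffmap (precomp_affine u h).

(* A family S of compact convex sets of affine maps into W that is stable under
   precomposition is a contravariant functor. Both Hom(-, A) and coker^*(f)
   have this form. *)
Section PrecompositionFunctor.
Variables (W : vectType R) (S : forall Z, set (affmap Z W)).
Hypothesis S_convex : forall Z, convex_set (S (Z := Z) : set (convex_lmodType _)).
Hypothesis S_compact : forall Z, compactv (S (Z := Z)).
Hypothesis S_precomp : forall Z Z' (h : homC Z' Z) u, S u -> S (precomp u h).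

Definition precomp_obj Z : Conv R := MkConv (@S_convex Z) (@S_compact Z).

Fact precomp_map_affine Z Z' (h : homC Z' Z) :
  affine ((fun u => @mkpt R (precomp_obj Z') _ (S_precomp h (pt_body u))) :
    precomp_obj Z -> precomp_obj Z').
Proof. by move=> t u v; apply/val_inj/affmap_ext. Qed.

Definition precomp_map Z Z' (h : homC Z' Z) :
    homC (precomp_obj Z) (precomp_obj Z') :=
  mkhom (precomp_map_affine h).

Lemma val_precomp_map Z Z' (h : homC Z' Z) u z :
  \val (app (precomp_map h) u) z = \val u (app h z).
Proof. by []. Qed.

Fact precomp_map_id Z : precomp_map (idC Z) = idC (precomp_obj Z).
Proof.
apply: hom_ext => u; apply/val_inj/affmap_ext => z.
by rewrite val_precomp_map !app_id.
Qed.

Fact precomp_map_comp Z Z' Z'' (h : homC Z' Z) (k : homC Z'' Z') :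
  precomp_map (compC h k) = compC (precomp_map k) (precomp_map h).
Proof.
apply: hom_ext => u; apply/val_inj/affmap_ext => z.
by rewrite app_comp !val_precomp_map app_comp.
Qed.

Definition precomp_functor : cofunctor :=
  MkCofunctor precomp_map_id precomp_map_comp.

End PrecompositionFunctor.

Fact hom_precomp A Z Z' (h : homC Z' Z) u :
  @hom_body R Z A u -> hom_body (precomp u h).
Proof. by move=> uA z; exact: uA. Qed.

Definition hom_functor A : cofunctor :=
  precomp_functor (fun Z => hom_convex (B := A)) (fun Z => hom_compact (B := A))
    (@hom_precomp A).

Lemma hom_functor_obj A Z : hom_functor A Z = homC Z A.
Proof. by []. Qed.

Lemma hom_functor_map A Z Z' (h : homC Z' Z) (u : homC Z A) :
  app (fhom (hom_functor A) h) u = compC u h.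
Proof. by apply/val_inj/affmap_ext. Qed.

Definition representable (F : cofunctor) := exists A, nat_iso F (hom_functor A).

End Category.

Section Cokernel.
Variables (R : realType) (X Y : Conv R) (f : homC X Y).

(* The direction of the affine hull of f(X). *)
Definition coker_dir : {vspace amb Y} :=
  vspan [set v | exists x x', v = \val (app f x) - \val (app f x')].

(* The linear projection along coker_dir onto a complement of it. The map
   coker_proj : Y -> coker below is its restriction to Y. By coker_coequalizer
   it is the coequalizer of f and a constant map with value in f(X), whenever X
   is nonempty; if X is empty it is the identity on Y. *)
Definition coker_lin : 'End(amb Y) := (\1 - projv coker_dir)%VF.

Definition coker : Conv R :=
  MkConv (convex_linear (L := coker_lin) (@body_convex R Y))
    (compactv_linear (L := coker_lin) (@body_compact R Y)).

Fact coker_proj_subproof (y : Y) : (coker_lin @` @body R Y) (coker_lin (\val y)).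
Proof. by exists (\val y) => //; exact: pt_body. Qed.

Fact coker_proj_affine :
  affine ((fun y => @mkpt R coker _ (coker_proj_subproof y)) : Y -> coker).
Proof. by move=> t x y; apply/val_inj; rewrite /= linear_conv. Qed.

Definition coker_proj : homC Y coker := mkhom coker_proj_affine.

Lemma val_coker_proj y : \val (app coker_proj y) = coker_lin (\val y).
Proof. by []. Qed.

Lemma coker_lin_eq u v : (coker_lin u == coker_lin v) = (u - v \in coker_dir).
Proof.
have E w : coker_lin w = w - projv coker_dir w.
  by rewrite /coker_lin add_lfunE opp_lfunE id_lfunE.
have -> : (coker_lin u == coker_lin v) = (coker_lin (u - v) == 0).
  by rewrite linearB subr_eq0.
rewrite E subr_eq0.
apply/eqP/idP => [->|/projv_id ->//]; exact: memv_proj.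
Qed.

Lemma coker_proj_const x x' : app coker_proj (app f x) = app coker_proj (app f x').
Proof.
apply/val_inj/eqP; rewrite !val_coker_proj coker_lin_eq.
by apply: mem_vspan; exists x, x'.
Qed.

Lemma coker_dirP (x0 : X) v : v \in coker_dir ->
  exists t x x', 0 <= t /\ v = t *: (\val (app f x) - \val (app f x')).
Proof.
pose S (w : amb Y) := exists t x x', 0 <= t /\ w = t *: (\val (app f x) - \val (app f x')).
have [U US] : exists U : {vspace amb Y}, forall w, w \in U <-> S w.
  apply: (@submod_vspace _ _ S); first by exists 0, x0, x0; rewrite scale0r.
  have SZ k w : S w -> S (k *: w).
    move=> [t [x [x' [t0 ->]]]]; have [k0|/ltW k0] := leP 0 k.
      by exists (k * t), x, x'; rewrite mulr_ge0// scalerA.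
    exists (- (k * t)), x', x; rewrite oppr_ge0 mulr_le0_ge0//; split=> //.
    by rewrite scaleNr -scalerN opprB scalerA.
  move=> k u w /(SZ k) [s [x [y [s0 ->]]]] [t [x' [y' [t0 ->]]]].
  move: s0; rewrite le_eqVlt => /orP[/eqP <-|s0].
    by exists t, x', y'; rewrite scale0r add0r.
  have [p pE] := conv_difference s0 t0.
  exists (s + t), (x <| p |> x'), (y <| p |> y'); split.
    by rewrite addr_ge0// ltW.
  by rewrite !app_affine pE.
suff sU : (coker_dir <= U)%VS by move=> /(subvP sU) /US.
apply: vspan_min => _ [x [x' ->]]; apply/US.
by exists 1, x, x'; rewrite scale1r.
Qed.

Lemma coker_proj_surj (c : coker) : exists y, app coker_proj y = c.
Proof.
have [v Yv vE] := pt_body c.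
by exists (mkpt Yv); apply/val_inj.
Qed.

Lemma coker_proj_eq (y y' : Y) (Z : Conv R) (rho : homC Y Z) (x0 : X) :
  (forall x, app rho (app f x) = app rho (app f x0)) ->
  app coker_proj y = app coker_proj y' -> app rho y = app rho y'.
Proof.
move=> rhof /(congr1 val) /eqP; rewrite !val_coker_proj coker_lin_eq.
move=> /(coker_dirP x0)[t [x [x' [t0 yE]]]].
have p1 : (1 + t)^-1 <= 1 by rewrite invf_le1 ?lerDl// ltr_wpDr.
have p0 : 0 <= (1 + t)^-1 by rewrite invr_ge0 addr_ge0.
have t1 : 1 + t != 0 by rewrite gt_eqF// ltr_wpDr.
pose p : {i01 R} := Itv01 p0 p1.
have E : y <| p |> app f x' = y' <| p |> app f x.
  apply/val_inj; rewrite !val_conv !conv_lmodE /=.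
  have -> : 1 - (1 + t)^-1 = (1 + t)^-1 * t.
    by rewrite -{1}(mulVf t1) mulrDr mulr1 addrAC subrr add0r.
  rewrite -!scalerA -!scalerDr; congr (_ *: _).
  by rewrite -(subrK (\val y') (\val y)) yE scalerBr addrAC subrK addrC.
have := congr1 (fun z => \val (app rho z)) E.
rewrite !app_affine !rhof !val_conv !conv_lmodE => /addIr /= /scalerI.
by move=> H; apply/val_inj/H; rewrite invr_eq0.
Qed.

Lemma coker_coequalizer (x0 : X) :
  compC coker_proj f = compC coker_proj (constC X (app f x0)) /\
  forall (Z : Conv R) (rho : homC Y Z),
    compC rho f = compC rho (constC X (app f x0)) ->
    exists! k : homC coker Z, compC k coker_proj = rho.
Proof.
split=> [|Z rho rhof].
  apply: hom_ext => x; rewrite !app_comp app_const; exact: coker_proj_const.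
have rhoE x : app rho (app f x) = app rho (app f x0).
  by rewrite -app_comp rhof app_comp app_const.
pose r c := sval (cid (coker_proj_surj c)).
have rK c : app coker_proj (r c) = c by exact: (svalP (cid (coker_proj_surj c))).
have kA : affine (app rho \o r).
  move=> t c d; rewrite /= -app_affine; apply: (coker_proj_eq rhoE).
  by rewrite app_affine !rK.
exists (mkhom kA); split=> [|k' k'E].
  apply: hom_ext => y; rewrite app_comp app_mkhom /=.
  by apply: (coker_proj_eq rhoE); rewrite rK.
by apply: hom_ext => c; rewrite app_mkhom /= -k'E app_comp rK.
Qed.

Definition coker_sim (Z : Conv R) (g1 g2 : homC Z Y) :=
  forall (Y' : Conv R) (rho : homC Y Y'),
    (exists y', range (app (compC rho f)) = [set y']) ->
    compC rho g1 = compC rho g2.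

Lemma coker_simP (x0 : X) (Z : Conv R) (g1 g2 : homC Z Y) :
  coker_sim g1 g2 <-> compC coker_proj g1 = compC coker_proj g2.
Proof.
split=> [|gE Y' rho [y' rhof]].
  apply; exists (app coker_proj (app f x0)).
  apply/seteqP; split=> [_ [x _ <-]|_ ->] /=.
    by rewrite app_comp; exact: coker_proj_const.
  by exists x0; rewrite // app_comp.
have rhoE x : app rho (app f x) = y'.
  have : range (app (compC rho f)) (app rho (app f x)) by exists x; rewrite // app_comp.
  by rewrite rhof.
apply: hom_ext => z; rewrite !app_comp; apply: (@coker_proj_eq _ _ _ _ x0).
  by move=> x; rewrite !rhoE.
by rewrite -!app_comp gE.
Qed.

(* coker^*(f)(Z) is the image of Hom(Z, coker_proj), which coker_simP identifies
   with the quotient of Hom(Z, Y) by coker_sim. *)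
Definition coker_star_body (Z : Conv R) : set (affmap Z (amb coker)) :=
  range (fun g : homC Z Y => \val (compC coker_proj g)).
Arguments coker_star_body Z : clear implicits.

Fact postcomp_subproof Z (u : affmap Z (amb Y)) :
  affine ((fun z => coker_lin (u z)) : Z -> convex_lmodType (amb coker)).
Proof. by move=> t x y; rewrite affmapP linear_conv. Qed.

Definition postcomp Z (u : affmap Z (amb Y)) : affmap Z (amb coker) :=
  mkaffmap (postcomp_subproof u).

Fact postcomp_linear Z : linear (@postcomp Z).
Proof.
move=> a u v; apply: affmap_ext => z.
by rewrite -[RHS]/(a *: coker_lin (u z) + coker_lin (v z)) -linearP.
Qed.

HB.instance Definition _ Z :=
  GRing.isLinear.Build R _ _ *:%R (@postcomp Z) (@postcomp_linear Z).

Let coker_star_bodyE (Z : Conv R) : coker_star_body Z = @postcomp Z @` @hom_body R Z Y.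
Proof.
apply/seteqP; split=> [_ [g _ <-]|_ [g gY <-]].
  by exists (\val g); [exact: (pt_body g) | exact: affmap_ext].
by exists (@mkpt R (homC Z Y) g gY) => //; exact: affmap_ext.
Qed.

Fact coker_star_convex Z : convex_set (coker_star_body Z : set (convex_lmodType _)).
Proof. by rewrite coker_star_bodyE; apply: convex_linear; exact: hom_convex. Qed.

Fact coker_star_compact Z : compactv (coker_star_body Z).
Proof. by rewrite coker_star_bodyE; apply: compactv_linear; exact: hom_compact. Qed.

Fact coker_star_precomp Z Z' (h : homC Z' Z) u :
  coker_star_body Z u -> coker_star_body Z' (precomp u h).
Proof.
move=> [g _ <-]; exists (compC g h) => //.
by apply: affmap_ext.
Qed.

Definition coker_star : cofunctor R :=
  precomp_functor coker_star_convex coker_star_compact coker_star_precomp.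

Definition coker_class Z (g : homC Z Y) : coker_star Z :=
  @mkpt R (coker_star Z) (\val (compC coker_proj g)) (ex_intro2 _ _ g I erefl).

Lemma coker_class_surj Z (u : coker_star Z) : exists g, coker_class g = u.
Proof. by have [g _ gE] := pt_body u; exists g; exact/val_inj. Qed.

Lemma coker_class_eq (x0 : X) Z (g1 g2 : homC Z Y) :
  coker_class g1 = coker_class g2 <-> coker_sim g1 g2.
Proof.
rewrite (coker_simP x0); split=> [/(congr1 val) E|E]; first exact: val_inj.
exact/val_inj/(congr1 val E).
Qed.

Lemma coker_class_map Z Z' (h : homC Z' Z) (g : homC Z Y) :
  app (fhom coker_star h) (coker_class g) = coker_class (compC g h).
Proof. exact/val_inj/affmap_ext. Qed.

End Cokernel.

Definition has_section (R : realType) (A B : Conv R) (p : homC A B) :=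
  exists s : homC B A, compC p s = idC B.

(* Main.v *)
Require Import Defs.
From mathcomp Require Import all_boot all_algebra boolp classical_sets all_reals convex.

(** This is the Yoneda lemma, together with the fact that an affine bijection
is an isomorphism.  Write [p] for the canonical map from [Y] to [coker f].
Recall that [coker_star f] sends [Z] to the set of those maps from [Z] to
[coker f] that lift along [p].

If [p] has a section [s], then every [u] lifts, namely to [s u].  So the two
functors consist of literally the same sets of maps with the same
precomposition action, and they are equal ([section_coker_star_body],
[precomp_functor_eq]).

Conversely, let [A] represent [coker_star f].  The universal element is the
class of some [g] from [A] to [Y].  By Yoneda, every map to [coker f] that
lifts factors uniquely as [p g h] ([representable_universal]).  Then [p g] is a
bijection: it is injective because two constant maps of [A] that become equal
under it are equal by uniqueness, and surjective because [p] itself lifts,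
hence factors through [p g], and [p] is surjective.  Its inverse [q] is affine
([bijective_has_section]), and [g q] is a section of [p]. *)

Section Category.
Variable R : realType.
Implicit Types A B C : Conv R.

Lemma compCA A B C D (h : homC C D) (g : homC B C) (f : homC A B) :
  compC h (compC g f) = compC (compC h g) f.
Proof. by apply: hom_ext => a; rewrite !app_comp. Qed.

Lemma comp_idC A B (g : homC A B) : compC (idC B) g = g.
Proof. by apply: hom_ext => a; rewrite app_comp app_id. Qed.

(** Affineness passes to the inverse because injectivity lets an equality of
points be tested after applying [p]. *)
Lemma bijective_has_section A B (p : homC A B) :
  injective (app p) -> (forall b, exists a, app p a = b) -> has_section p.
Proof.
move=> pI pS; have [q qK] := choice pS.
have qA : affine q by move=> t x y; apply: pI; rewrite app_affine !qK.
by exists (mkhom qA); apply: hom_ext => b; rewrite app_comp app_mkhom app_id.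
Qed.

Lemma nat_iso_refl (F : cofunctor R) : nat_iso F F.
Proof.
by exists (fun Z => idC (F Z)), (fun Z => idC (F Z)); split=> *;
  apply: hom_ext => u; rewrite !app_comp !app_id.
Qed.

(** Equality on the nose, and not only up to isomorphism: once the families
agree, the functors differ only by proofs of propositions. *)
Lemma precomp_functor_eq (W : vectType R) (S T : forall Z, set (affmap Z W))
    S_convex S_compact S_precomp T_convex T_compact T_precomp :
  (forall Z, S Z = T Z) ->
  @precomp_functor R W S S_convex S_compact S_precomp =
  @precomp_functor R W T T_convex T_compact T_precomp.
Proof.
move=> ST; have {ST} ST : S = T by exact: functional_extensionality_dep.
by subst T; congr precomp_functor; exact: Prop_irrelevance.
Qed.

End Category.

Section Cokernel.
Variables (R : realType) (X Y : Conv R) (f : homC X Y).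
Local Notation p := (coker_proj f).

Lemma section_coker_star_body Z :
  has_section p -> @coker_star_body R X Y f Z = @hom_body R Z (coker f).
Proof.
move=> [s ps]; apply/seteqP; split=> [_ [g _ <-]|u uP]; first exact: (pt_body (compC p g)).
pose v : homC Z (coker f) := @mkpt R (homC Z (coker f)) u uP.
by exists (compC s v) => //; rewrite compCA ps comp_idC.
Qed.

Lemma section_coker_star : has_section p -> coker_star f = hom_functor (coker f).
Proof. by move=> ps; apply: precomp_functor_eq => Z; exact: section_coker_star_body. Qed.

(** The Yoneda lemma: [g] is a lift of the universal element, that is, of the
element of [coker_star f A] that corresponds to the identity of [A]. *)
Lemma representable_universal : representable (coker_star f) ->
  exists A (g : homC A Y),
    (forall Z (k : homC Z Y), exists h : homC Z A,
       compC p k = compC p (compC g h)) /\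
    (forall Z (h h' : homC Z A),
       compC p (compC g h) = compC p (compC g h') -> h = h').
Proof.
move=> [A [phi [psi [psiK phiK phi_nat]]]]; exists A.
have phiI Z : injective (app (phi Z)).
  move=> u v E; have := congr1 (app (psi Z)) E.
  by rewrite -!app_comp psiK !app_id.
have [g gE] := coker_class_surj (app (psi A) (idC A : hom_functor A A)).
have phig : app (phi A) (coker_class f g) = (idC A : hom_functor A A).
  by rewrite gE -app_comp phiK app_id.
(* Naturality determines the isomorphism by its value at the universal element. *)
have phi_class Z (h : homC Z A) : app (phi Z) (coker_class f (compC g h)) = h.
  rewrite -coker_class_map -app_comp phi_nat app_comp phig hom_functor_map.
  exact: comp_idC.
exists g; split=> [Z k|Z h h' E].
  exists (app (phi Z) (coker_class f k) : homC Z A).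
  have /phiI/(congr1 val) E := phi_class Z (app (phi Z) (coker_class f k)).
  by apply/val_inj; rewrite -[LHS]/(val (coker_class f k)) -E.
rewrite -(phi_class _ h) -(phi_class _ h'); congr (app _ _).
exact/val_inj/(congr1 val E).
Qed.

Lemma representable_has_section : representable (coker_star f) -> has_section p.
Proof.
move=> /representable_universal[A [g [fac inj]]].
have [||q qE] := @bijective_has_section R _ _ (compC p g).
- move=> a a' E.
  have : constC A a = constC A a'.
    by apply: inj; apply: hom_ext => b; rewrite !app_comp !app_const -!app_comp.
  by move=> /(congr1 (fun h => app h a)); rewrite !app_const.
- move=> c; have [y <-] := coker_proj_surj c; have [h hE] := fac _ (idC Y).
  exists (app h y); have := congr1 (fun k => app k y) hE.
  by rewrite !app_comp app_id.
- by exists (compC g q); rewrite compCA.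
Qed.

End Cokernel.

Theorem proposition7p3 (R : realType) (X Y : Conv R) (f : homC X Y) :
  (representable (coker_star f) <-> has_section (coker_proj f)) /\
  (has_section (coker_proj f) -> coker_star f = hom_functor (coker f)).
Proof.
split; last exact: section_coker_star.
split; first exact: representable_has_section.
by move=> /section_coker_star ->; exists (coker f); exact: nat_iso_refl.
Qed.
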